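(* Let $Z\in\mathbb{R}^{p_1\times p_2}$ have independent entries $Z_{ij}\sim N(0,\sigma_j^2)$, where $\sigma_1,\dots,\sigma_{p_2}\ge 0$. Then there is a universal constant $c>0$ such that \[ \mathbb{E}\|ZZ^\top-\mathbb{E}ZZ^\top\|\ge c\left(\sqrt{p_1\sum_{j}\sigma_j^4}+p_1\max_j\sigma_j^2\right). \]
   Context: $\|\cdot\|$ is the spectral norm. *)

(* Defs.v *)
From HB Require Import structures.
From mathcomp Require Import all_boot all_order all_algebra.
From mathcomp Require Import all_classical all_reals all_analysis.
From mathcomp Require Import Rstruct Rstruct_topology.
Set Implicit Arguments. Unset Strict Implicit. Unset Printing Implicit Defensive.
Import Order.TTheory GRing.Theory Num.Theory.
Local Open Scope classical_set_scope.
Local Open Scope ring_scope.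

Section defs.
Context {R : realType}.

Definition spec_norm (n m : nat) (M : 'M[R]_(n, m)) : R :=
  sup [set Num.sqrt (\sum_(i < n) ((M *m x) i ord0) ^+ 2) |
       x in [set x : 'cV[R]_m | \sum_(j < m) (x j ord0) ^+ 2 <= 1]].

(* The law N(0, s^2) on R, for a standard deviation s >= 0; for s = 0 this is
   the point mass at 0 (degenerate Gaussian). *)
Definition gauss_law (s : R) (A : set R) : \bar R :=
  if s == 0 then ((\1_A 0 : R)%:E) else normal_prob 0 s A.

Definition borel_set (A : set R) : Prop := measurable A.

Definition entries_measurable d (T : measurableType d) (p1 p2 : nat)
    (Z : T -> 'M[R]_(p1, p2)) : Prop :=
  forall i j, measurable_fun setT (fun w => Z w i j).

Definition entries_independent d (T : measurableType d) (P : probability T R)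
    (p1 p2 : nat) (Z : T -> 'M[R]_(p1, p2)) : Prop :=
  forall A : 'I_p1 -> 'I_p2 -> set R, (forall i j, measurable (A i j)) ->
    P [set w | forall i j, A i j (Z w i j)] =
    (\prod_(i < p1) \prod_(j < p2) P [set w | A i j (Z w i j)])%E.

Definition expect d (T : measurableType d) (P : probability T R) (X : T -> R) : R :=
  fine (\int[P]_w (X w)%:E)%E.

Definition expect_mx d (T : measurableType d) (P : probability T R) (n m : nat)
    (X : T -> 'M[R]_(n, m)) : 'M[R]_(n, m) :=
  \matrix_(i, j) expect P (fun w => X w i j).

End defs.

(* Main.v *)
Require Import Defs.
From HB Require Import structures.
From mathcomp Require Import all_boot all_order all_algebra.
From mathcomp Require Import all_classical all_reals all_analysis.
From mathcomp Require Import Rstruct Rstruct_topology.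
From mathcomp Require Import ring lra measurable_realfun.
Import Order.TTheory GRing.Theory Num.Theory.
Import numFieldNormedType.Exports.
Set Implicit Arguments.
Unset Strict Implicit.
Unset Printing Implicit Defensive.
Local Open Scope classical_set_scope.
Local Open Scope ring_scope.

(** Write A = ZZ^T - E ZZ^T and p = p1. Testing A against unit vectors gives two
    lower bounds for its norm. First, ||A e_k|| >= p^(-1/2) sum_i |A_ik|, where
    each A_ik is a sum over j of independent centered variables, of variance at
    least s_j^4 and of fourth moment at most 15 times the squared variance; hence
    E|A_ik| >= c sqrt(sum_j s_j^4), and summing over i bounds E||A|| below by a
    multiple of sqrt(p sum_j s_j^4). Second, for a fixed column j the unit vector
    x = p^(-1/2) (sign Z_ij)_i satisfies ||A|| >= x^T A x, and independence kills
    in E x^T A x every contribution of the other columns and of the diagonal,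
    leaving p^(-1) sum_(i <> k) E|Z_ij| E|Z_kj| >= c^2 (p - 1) s_j^2. Since
    max_j s_j^2 <= sqrt(p sum_j s_j^4), the missing multiple of max_j s_j^2 in the
    second bound is covered by the first. *)

(** * Integrals against weights and image laws *)

Section weighted_integral.
Context d (T : measurableType d) (R : realType).

Import HBNNSimple.

(** A simple function is a finite combination of indicators of its level sets, so the weighted
    integral reduces to indicators. The weight [G] will be a density, a constant, or the product of
    the other independent factors. *)
Lemma weighted_integral_nnsfun (m : {measure set T -> \bar R}) (G X : T -> R)
    (h : {nnsfun R >-> R}) :
  measurable_fun setT G -> measurable_fun setT X -> (forall x, 0 <= G x) ->
  (\int[m]_x (G x * h (X x))%:E =
   \sum_(y \in range h) y%:E * \int[m]_x (G x * \1_(h @^-1` [set y]) (X x))%:E)%E.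
Proof.
move=> mG mX G0.
have m1h y : measurable_fun setT (fun x => G x * \1_(h @^-1` [set y]) (X x)).
  by apply: measurable_funM => //; apply: measurableT_comp.
have h0 y : range h y -> 0 <= y by move=> [x _ <-].
(* Writing [|y|] makes every term nonnegative for all [y], not only for [y] in the range, as the
   exchange of sum and integral demands. *)
transitivity (\int[m]_x (\sum_(y \in range h)
    (`|y| * (G x * \1_(h @^-1` [set y]) (X x)))%:E))%E.
  apply: eq_integral => x _; rewrite fsumEFin//; congr EFin.
  rewrite fimfunE mulr_fsumr; apply: eq_fsbigr => y /set_mem /h0 y0.
  by rewrite ger0_norm// mulrCA.
rewrite ge0_integral_fsum//; last 2 first.
  - move=> y; apply/measurable_EFinP; exact: measurable_funM.
  - by move=> y x _; rewrite lee_fin !mulr_ge0.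
apply: eq_fsbigr => y /set_mem /h0 y0; rewrite ger0_norm//.
under eq_integral do rewrite EFinM.
rewrite ge0_integralZl//; first exact/measurable_EFinP.
by move=> x _; rewrite lee_fin mulr_ge0.
Qed.

(** Monotone convergence: composing the increasing simple approximations of [f] with [X] and
    multiplying by [G >= 0] keeps them increasing. *)
Lemma weighted_cvg_nnsfun (m : {measure set T -> \bar R}) (G X : T -> R) (f : R -> R)
    (mf : measurable_fun setT (EFin \o f)) :
  (forall x, 0 <= f x) ->
  measurable_fun setT G -> measurable_fun setT X -> (forall x, 0 <= G x) ->
  (\int[m]_x (G x * nnsfun_approx measurableT mf n (X x))%:E @[n --> \oo] -->
   \int[m]_x (G x * f (X x))%:E)%E.
Proof.
move=> f0 mG mX G0.
rewrite [X in _ --> X](_ : _ = \int[m]_x (limn (fun n =>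
    (G x * nnsfun_approx measurableT mf n (X x))%:E)))%E; last first.
  apply: eq_integral => x _; apply: esym; apply: cvg_lim; first exact: ereal_hausdorff.
  under eq_fun do rewrite EFinM.
  rewrite EFinM; apply: cvgeZl => //.
  by apply: (@cvg_nnsfun_approx _ _ _ _ measurableT _ mf) => // y _; rewrite lee_fin.
apply: cvg_monotone_convergence => //.
- move=> n; apply/measurable_EFinP; apply: measurable_funM => //.
  exact: measurableT_comp.
- by move=> n x _; rewrite lee_fin mulr_ge0.
- move=> x _ a b ab; rewrite lee_fin ler_wpM2l//.
  by have /lefP := @nd_nnsfun_approx _ _ _ _ measurableT _ mf a b ab; exact.
Qed.

End weighted_integral.

Section weighted_transfer.
Context d1 d2 (T1 : measurableType d1) (T2 : measurableType d2) (R : realType).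
Variables (m1 : {measure set T1 -> \bar R}) (m2 : {measure set T2 -> \bar R}).
Variables (G1 X1 : T1 -> R) (G2 X2 : T2 -> R).
Hypotheses (mG1 : measurable_fun setT G1) (mX1 : measurable_fun setT X1).
Hypotheses (mG2 : measurable_fun setT G2) (mX2 : measurable_fun setT X2).
Hypotheses (G10 : forall x, 0 <= G1 x) (G20 : forall x, 0 <= G2 x).
Hypothesis eq_indic : forall A : set R, measurable A ->
  (\int[m1]_x (G1 x * \1_A (X1 x))%:E = \int[m2]_x (G2 x * \1_A (X2 x))%:E)%E.

Import HBNNSimple.

(** Both sides use the same simple approximations of [f]; their integrals agree by [eq_indic], hence
    so do the limits. This serves both for image laws and for splitting off one independent
    factor. *)
Lemma weighted_transfer (f : R -> R) :
  measurable_fun setT f -> (forall x, 0 <= f x) ->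
  (\int[m1]_x (G1 x * f (X1 x))%:E = \int[m2]_x (G2 x * f (X2 x))%:E)%E.
Proof.
move=> /measurable_EFinP mf f0.
have c1 := weighted_cvg_nnsfun (m := m1) mf f0 mG1 mX1 G10.
have c2 := weighted_cvg_nnsfun (m := m2) mf f0 mG2 mX2 G20.
suff c12 : (fun n => \int[m1]_x (G1 x * nnsfun_approx measurableT mf n (X1 x))%:E)%E =
    (fun n => \int[m2]_x (G2 x * nnsfun_approx measurableT mf n (X2 x))%:E)%E.
  by rewrite c12 in c1; apply: (cvg_unique _ c1 c2); exact: ereal_hausdorff.
apply/funext => n; rewrite !weighted_integral_nnsfun//.
by apply: eq_fsbigr => y _; rewrite eq_indic.
Qed.

(** Integrability transfers through [|f|]; the value transfers through the difference of nonnegative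
    functions [f = |f| - (|f| - f)]. *)
Lemma weighted_transfer_integrable (f : R -> R) : measurable_fun setT f ->
  m2.-integrable setT (fun x => (G2 x * f (X2 x))%:E) ->
  m1.-integrable setT (fun x => (G1 x * f (X1 x))%:E) /\
  (\int[m1]_x (G1 x * f (X1 x))%:E = \int[m2]_x (G2 x * f (X2 x))%:E)%E.
Proof.
move=> mf if2.
have H (g : R -> R) : measurable_fun setT g ->
    m2.-integrable setT (fun x => (G2 x * g (X2 x))%:E) ->
    m1.-integrable setT (fun x => (G1 x * g (X1 x))%:E).
  move=> mg /integrableP[_ ig2]; apply/integrableP; split.
    apply/measurable_EFinP; apply: measurable_funM => //.
    exact: measurableT_comp.
  rewrite (_ : (\int[m1]_x _)%E = \int[m2]_x `|(G2 x * g (X2 x))%:E|)%E//.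
  under eq_integral do rewrite /= normrM ger0_norm//.
  under [RHS]eq_integral do rewrite /= normrM ger0_norm//.
  by apply: (weighted_transfer (f := fun x => `|g x|)) => //; exact: measurableT_comp.
have if1 := H _ mf if2.
pose p x := `|f x|; pose q x := `|f x| - f x.
have mp : measurable_fun setT p by exact: measurableT_comp.
have mq : measurable_fun setT q by exact: measurable_funB.
have q0 x : 0 <= q x by rewrite subr_ge0 ler_norm.
have ip2 : m2.-integrable setT (fun x => (G2 x * p (X2 x))%:E).
  have := integrable_norm if2; apply: eq_integrable => // x _.
  by rewrite /= normrM ger0_norm.
have iq2 : m2.-integrable setT (fun x => (G2 x * q (X2 x))%:E).
  have := integrableB measurableT ip2 if2; apply: eq_integrable => // x _.
  by rewrite /= -EFinB -mulrBr.
have ip1 := H _ mp ip2; have iq1 := H _ mq iq2.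
split => //.
transitivity (\int[m1]_x ((G1 x * p (X1 x))%:E - (G1 x * q (X1 x))%:E))%E.
  by apply: eq_integral => x _; rewrite -EFinB -mulrBr subKr.
transitivity (\int[m2]_x ((G2 x * p (X2 x))%:E - (G2 x * q (X2 x))%:E))%E.
  rewrite integralB_EFin// [RHS]integralB_EFin//.
  by rewrite (weighted_transfer mq q0) (weighted_transfer mp)// => x; exact: normr_ge0.
by apply: eq_integral => x _; rewrite -EFinB -mulrBr subKr.
Qed.

End weighted_transfer.

(** * Expectations of products of independent variables *)

Section has_expectation.
Context d (T : measurableType d) (R : realType) (P : probability T R).
Implicit Types (F G : T -> R) (u v : R).

(** Integrability and value are kept together because [expect] goes through [fine], which sends
    infinite integrals to 0; in this form linear rules need no side conditions. *)
Definition has_expectation F v :=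
  P.-integrable setT (EFin \o F) /\ (\int[P]_w (F w)%:E = v%:E)%E.

Lemma has_expectation_expect F v : has_expectation F v -> expect P F = v.
Proof. by move=> [_ Fv]; rewrite /expect Fv. Qed.

Lemma eq_has_expectation F G v :
  F =1 G -> has_expectation F v -> has_expectation G v.
Proof. by move=> /funext ->. Qed.

Lemma has_expectation_measurable F v :
  has_expectation F v -> measurable_fun setT F.
Proof. by move=> [/integrableP[/measurable_EFinP]]. Qed.

Lemma has_expectationD F G u v : has_expectation F u -> has_expectation G v ->
  has_expectation (fun w => F w + G w) (u + v).
Proof.
move=> [iF eF] [iG eG]; split.
  rewrite (_ : _ \o _ = (EFin \o F) \+ (EFin \o G))%E; last exact/funext.
  exact: integrableD.
by under eq_integral do rewrite EFinD; rewrite integralD_EFin// eF eG.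
Qed.

Lemma has_expectationZ F v k : has_expectation F v ->
  has_expectation (fun w => k * F w) (k * v).
Proof.
move=> [iF eF]; split.
  rewrite (_ : _ \o _ = fun x => k%:E * (EFin \o F) x)%E; last exact/funext.
  exact: integrableZl.
by under eq_integral do rewrite EFinM; rewrite integralZl// eF.
Qed.

Lemma has_expectationN F v : has_expectation F v ->
  has_expectation (fun w => - F w) (- v).
Proof.
move=> /(has_expectationZ (-1)); rewrite mulN1r; apply: eq_has_expectation.
by move=> w; rewrite mulN1r.
Qed.

Lemma has_expectationB F G u v : has_expectation F u -> has_expectation G v ->
  has_expectation (fun w => F w - G w) (u - v).
Proof. by move=> eF eG; apply: has_expectationD => //; exact: has_expectationN. Qed.

Lemma has_expectation_cst v : has_expectation (fun=> v) v.
Proof.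
split; first exact: finite_measure_integrable_cst.
by rewrite integral_cst//= probability_setT mule1.
Qed.

Lemma has_expectation_sum (I : Type) (r : seq I) (Q : pred I) (F : I -> T -> R)
    (v : I -> R) : (forall i, Q i -> has_expectation (F i) (v i)) ->
  has_expectation (fun w => \sum_(i <- r | Q i) F i w) (\sum_(i <- r | Q i) v i).
Proof.
move=> eF; elim: r => [|i r IHr].
  rewrite big_nil; apply: eq_has_expectation (has_expectation_cst 0).
  by move=> w; rewrite big_nil.
rewrite big_cons; case: ifPn => Qi.
  apply: (eq_has_expectation _ (has_expectationD (eF _ Qi) IHr)) => w.
  by rewrite big_cons Qi.
by apply: (eq_has_expectation _ IHr) => w; rewrite big_cons (negbTE Qi).
Qed.

Lemma ge0_has_expectation F v : measurable_fun setT F -> (forall w, 0 <= F w) ->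
  (\int[P]_w (F w)%:E = v%:E)%E -> has_expectation F v.
Proof.
move=> mF F0 eF; split=> //; apply/integrableP; split; first exact/measurable_EFinP.
under eq_integral => w _ do rewrite /= ger0_norm//.
by rewrite eF ltry.
Qed.

Lemma has_expectation_norm F v : has_expectation F v ->
  has_expectation (fun w => `|F w|) (expect P (fun w => `|F w|)).
Proof.
move=> [iF eF]; have iF' := integrable_norm iF; split => //.
by rewrite fineK//; exact: integrable_fin_num.
Qed.

Lemma le_has_expectation F G u v : has_expectation F u -> has_expectation G v ->
  (forall w, F w <= G w) -> u <= v.
Proof.
move=> [iF eF] [iG eG] FG; rewrite -lee_fin -eF -eG.
by apply: le_integral => // w _; rewrite lee_fin.
Qed.

End has_expectation.

(** * Multiplicativity of expectation for a finite independent family *)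

Section independent_family.
Context d (T : measurableType d) (R : realType) (P : probability T R).
Context (K : finType) (X : K -> T -> R).
Hypothesis mX : forall k, measurable_fun setT (X k).
Hypothesis indX : forall A : K -> set R, (forall k, measurable (A k)) ->
  P [set w | forall k, A k (X k w)] = (\prod_k P (X k @^-1` A k))%E.

Let upd (U : Type) (f : K -> U) (k : K) (y : U) : K -> U :=
  fun l => if l == k then y else f l.

Let prod_upd (f : K -> R -> R) k g w :
  \prod_l (upd f k g l) (X l w) = (\prod_(l | l != k) f l (X l w)) * g (X k w).
Proof.
rewrite (bigD1 k)//= /upd eqxx mulrC; congr (_ * _).
by apply: eq_bigr => l /negbTE ->.
Qed.

Let prod_updv (v : K -> R) k y :
  \prod_l upd v k y l = (\prod_(l | l != k) v l) * y.
Proof.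
rewrite (bigD1 k)//= /upd eqxx mulrC; congr (_ * _).
by apply: eq_bigr => l /negbTE ->.
Qed.

Let measurable_prodX (Q : pred K) (f : K -> R -> R) :
  (forall k, measurable_fun setT (f k)) ->
  measurable_fun setT (fun w => \prod_(k | Q k) f k (X k w)).
Proof.
move=> mf; rewrite (_ : (fun _ => _) =
    fun w => \prod_k (if Q k then f k (X k w) else 1)); last first.
  by apply/funext => w; rewrite big_mkcond.
apply: measurable_prod => k _; case: (Q k) => //.
exact: measurableT_comp.
Qed.

Let probE k A : measurable A -> (\int[P]_w (\1_A (X k w))%:E)%E = P (X k @^-1` A).
Proof.
move=> mA; rewrite (_ : (fun w => _) = fun w => (\1_(X k @^-1` A) w)%:E)//.
rewrite integral_indic ?setIT// -[X in measurable X]setTI.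
exact: mX.
Qed.

(** Induction on the list [s] of indices whose factor need not be an indicator. With [s] empty the
    claim is independence of events; each step upgrades one factor from indicators to a general
    nonnegative function. *)
Lemma indep_prod_ge0 (f : K -> R -> R) (v : K -> R) :
  (forall k, measurable_fun setT (f k)) -> (forall k x, 0 <= f k x) ->
  (forall k, \int[P]_w (f k (X k w))%:E = (v k)%:E)%E ->
  (\int[P]_w (\prod_k f k (X k w))%:E = (\prod_k v k)%:E)%E.
Proof.
move=> mf f0 fv.
suff H (s : seq K) : forall (f : K -> R -> R) (v : K -> R),
    (forall k, measurable_fun setT (f k)) ->
    (forall k x, 0 <= f k x) ->
    (forall k, \int[P]_w (f k (X k w))%:E = (v k)%:E)%E ->
    (forall k, k \notin s -> exists2 A, measurable A & f k = \1_A) ->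
    (\int[P]_w (\prod_k f k (X k w))%:E = (\prod_k v k)%:E)%E.
  by apply: (H (enum K)) => // k; rewrite mem_enum.
elim: s => [|k s IHs] {}f {}v {}mf {}f0 {}fv fs.
  have {fs} : forall k, exists A, measurable A /\ f k = \1_A.
    by move=> k; have [A mA fA] := fs k isT; exists A.
  move=> /choice[A mfA].
  have mA k : measurable (A k) by have [] := mfA k.
  have fA k : f k = \1_(A k) by have [] := mfA k.
  have mXA k : measurable (X k @^-1` A k) by rewrite -[X in measurable X]setTI; exact: mX.
  transitivity (\int[P]_w (\1_[set w | forall k, A k (X k w)] w)%:E)%E.
    apply: eq_integral => w _; congr EFin.
    have [Aw|nAw] := pselect (forall k, A k (X k w)).
      rewrite indicE mem_set// big1// => k _.
      by rewrite fA indicE mem_set.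
    rewrite indicE memNset//.
    have [k nAk] : exists k, ~ A k (X k w) by exact/existsNP.
    by rewrite (bigD1 k)//= fA indicE memNset// mul0r.
  rewrite integral_indic//; last first.
    rewrite (_ : [set w | _] = \bigcap_(k in setT) (X k @^-1` A k)).
      by apply: fin_bigcap_measurable => //; exact: finite_finset.
    by apply/seteqP; split=> w /= Aw k //=; exact: Aw.
  rewrite setIT/= indX// -prodEFin; apply: eq_bigr => k _.
  by rewrite -probE// -fv; apply: eq_integral => w _; rewrite fA.
set G := fun w => \prod_(l | l != k) f l (X l w).
set c := \prod_(l | l != k) v l.
have v0 l : 0 <= v l.
  by rewrite -lee_fin -fv; apply: integral_ge0 => w _; rewrite lee_fin.
have c0 : 0 <= c by exact: prodr_ge0.
(* The weight is the product of the other factors on one side and the constant [c], its expected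
   value, on the other. Agreement on indicators is the induction hypothesis with [f k] replaced by
   an indicator. *)
have := @weighted_transfer _ _ _ _ R P P G (X k) (cst c) (X k).
move=> /(_ _ _ _ _ _ _ _ (f k) (mf k) (f0 k)) H.
transitivity (\int[P]_w (G w * f k (X k w))%:E)%E.
  by apply: eq_integral => w _; rewrite (bigD1 k)//= mulrC.
rewrite H//; last first.
- move=> A mA.
  have mPA : P (X k @^-1` A) \is a fin_num.
    by apply: fin_num_measure; rewrite -[X in measurable X]setTI; exact: mX.
  have := IHs (upd f k \1_A) (upd v k (fine (P (X k @^-1` A)))).
  rewrite prod_updv => IH.
  transitivity (\int[P]_w (\prod_l upd f k \1_A l (X l w))%:E)%E.
    by apply: eq_integral => w _; rewrite prod_upd.
  rewrite IH.
  + rewrite EFinM fineK// -probE// -ge0_integralZl//.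
    * apply/measurable_EFinP; exact: measurableT_comp.
  + by move=> l; rewrite /upd; case: eqP.
  + by move=> l x; rewrite /upd; case: eqP.
  + move=> l; rewrite /upd; case: eqP => // ->.
    by rewrite probE// fineK.
  + move=> l ls; rewrite /upd; case: eqP => [_|/eqP lk]; first by exists A.
    by apply: fs; rewrite inE negb_or lk.
- by move=> w; exact: prodr_ge0.
- exact: measurable_prodX.
under eq_integral do rewrite EFinM/=.
rewrite ge0_integralZl//.
- by rewrite fv -EFinM (bigD1 k)//= mulrC.
- by apply/measurable_EFinP; exact: measurableT_comp.
- by move=> w _; rewrite lee_fin.
Qed.

(** The same induction, with [s] now listing the factors that may change sign; the nonnegative case
    is the base. *)
Lemma indep_prod (f : K -> R -> R) (v : K -> R) :
  (forall k, measurable_fun setT (f k)) ->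
  (forall k, has_expectation P (fun w => f k (X k w)) (v k)) ->
  has_expectation P (fun w => \prod_k f k (X k w)) (\prod_k v k).
Proof.
move=> mf fv.
suff H (s : seq K) : forall (f : K -> R -> R) (v : K -> R),
    (forall k, measurable_fun setT (f k)) ->
    (forall k, has_expectation P (fun w => f k (X k w)) (v k)) ->
    (forall k, k \notin s -> forall x, 0 <= f k x) ->
    has_expectation P (fun w => \prod_k f k (X k w)) (\prod_k v k).
  by apply: (H (enum K)) => // k; rewrite mem_enum.
elim: s => [|k s IHs] {}f {}v {}mf {}fv fs.
  apply: ge0_has_expectation => //.
  - exact: measurable_prodX.
  - by move=> w; apply: prodr_ge0 => k _; exact: fs.
  - apply: indep_prod_ge0 => //; first by move=> k x; exact: fs.
    by move=> k; have [] := fv k.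
(* Positive and negative parts of [f k]: their expectations come from [(|f| + f) / 2] and
   [(|f| - f) / 2], and the induction hypothesis applies to each part separately. *)
pose fp x := Num.max (f k x) 0; pose fn x : R := Num.max (- f k x) 0.
have fE x : f k x = fp x - fn x.
  rewrite /fp /fn; case: (leP (f k x) 0) => fx.
    by rewrite max_l ?oppr_ge0// sub0r opprK.
  by rewrite max_r ?subr0// oppr_le0 ltW.
have nE x : `|f k x| = fp x + fn x.
  rewrite /fp /fn; case: (leP (f k x) 0) => fx.
    by rewrite max_l ?oppr_ge0// add0r ler0_norm.
  by rewrite max_r ?addr0 ?oppr_le0 1?ltW// gtr0_norm.
have /has_expectation_norm := fv k; set u := expect _ _ => nv.
have efp : has_expectation P (fun w => fp (X k w)) (2^-1 * (u + v k)).
  apply: (eq_has_expectation _ (has_expectationZ 2^-1 (has_expectationD nv (fv k)))).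
  by move=> w /=; rewrite nE fE; field.
have efn : has_expectation P (fun w => fn (X k w)) (2^-1 * (u - v k)).
  apply: (eq_has_expectation _ (has_expectationZ 2^-1 (has_expectationB nv (fv k)))).
  by move=> w /=; rewrite nE fE; field.
have step (g : R -> R) (y : R) : measurable_fun setT g -> (forall x, 0 <= g x) ->
    has_expectation P (fun w => g (X k w)) y ->
    has_expectation P (fun w => (\prod_(l | l != k) f l (X l w)) * g (X k w))
      ((\prod_(l | l != k) v l) * y).
  move=> mg g0 gy; rewrite -prod_updv.
  apply: (@eq_has_expectation _ _ _ _ (fun w => \prod_l upd f k g l (X l w))).
    by move=> w; rewrite prod_upd.
  apply: IHs => l.
  - by rewrite /upd; case: eqP.
  - by rewrite /upd; case: eqP => // ->.
  - rewrite /upd; case: eqP => // /eqP lk ls; apply: fs.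
    by rewrite inE negb_or lk.
have mfp : measurable_fun setT fp by apply: measurable_maxr.
have mfn : measurable_fun setT fn.
  by apply: measurable_maxr => //; exact: measurableT_comp.
have := has_expectationB (step _ _ mfp _ efp) (step _ _ mfn _ efn).
rewrite [X in has_expectation _ _ X](_ : _ = \prod_k v k); last first.
  by rewrite [RHS](bigD1 k)//=; field.
move=> H; apply: (eq_has_expectation _ (H _ _)).
- by move=> w; rewrite [RHS](bigD1 k)//= -mulrBr -fE mulrC.
- by move=> x; rewrite /fp le_max lexx orbT.
- by move=> x; rewrite /fn le_max lexx orbT.
Qed.

End independent_family.

(** * Moments of the centered Gaussian law *)

Section gaussian_moments.
Context {R : realType}.
Local Notation mu := (@lebesgue_measure R).

Lemma exprn_le_fact_expR (y : R) n : 0 <= y -> y ^+ n <= n`!%:R * expR y.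
Proof.
move=> y0; case: n => [|n].
  rewrite expr0 fact0 mul1r; apply: le_trans (expR_ge1Dx y).
  by rewrite lerDl.
rewrite mulrC -ler_pdivrMr ?ltr0n ?fact_gt0//.
apply: le_trans (expR_ge1Dxn n y0).
by rewrite lerDr.
Qed.

(** Half of the Gaussian exponent absorbs the polynomial; the other half is a Gaussian with
    deviation [sqrt 2 * s]. This yields both integrability and decay of the moments' integrands. *)
Lemma normal_pdf_dominated (s : R) n : s != 0 ->
  exists C, 0 <= C /\ forall x,
    `|x| ^+ n * normal_pdf 0 s x <= C * normal_pdf 0 (Num.sqrt 2 * s) x.
Proof.
move=> s0; have s20 : Num.sqrt 2 * s != 0.
  by rewrite mulf_neq0// gt_eqF// sqrtr_gt0.
rewrite !normal_pdfE//.
(* With [y = x^2 / (4 s^2)], the two summands of [K * expR y] dominate those of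
   [1 + x^(2n) >= |x|^n]. *)
set s2 := Num.sqrt 2 * s; pose K : R := 1 + (4 * s ^+ 2) ^+ n * n`!%:R.
have K0 : 0 <= K by rewrite addr_ge0// !mulr_ge0// exprn_ge0// mulr_ge0// sqr_ge0.
have p0 := normal_peak_gt0 s20.
exists (K * normal_peak s / normal_peak s2); split.
  by rewrite !mulr_ge0// ?invr_ge0 ?normal_peak_ge0.
move=> x.
have -> : K * normal_peak s / normal_peak s2 * (normal_peak s2 * normal_fun 0 s2 x) =
    normal_peak s * (K * normal_fun 0 s2 x) by field; rewrite gt_eqF.
rewrite mulrCA ler_wpM2l ?normal_peak_ge0//.
pose y := x ^+ 2 / (4 * s ^+ 2).
have ss : 0 < 4 * s ^+ 2 by rewrite mulr_gt0// exprn_even_gt0.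
have y0 : 0 <= y by rewrite divr_ge0 ?sqr_ge0// ltW.
have -> : normal_fun 0 s x = expR (- y) * expR (- y).
  rewrite /normal_fun subr0 -exp.expRD; congr expR; rewrite /y.
  by rewrite -mulr_natr; field.
have -> : normal_fun 0 s2 x = expR (- y).
  rewrite /normal_fun subr0; congr expR; rewrite /y /s2 exprMn sqr_sqrtr//.
  by rewrite -mulr_natr; field.
rewrite mulrA ler_wpM2r ?expR_ge0//.
rewrite expRN ler_pdivrMr ?expR_gt0//.
have xn : `|x| ^+ n <= 1 + (x ^+ 2) ^+ n.
  rewrite -(real_normK (num_real x)) -exprM mulnC exprM.
  set t := `|x| ^+ n; have t0 : 0 <= t by exact: exprn_ge0.
  have : 0 <= (t - 1) ^+ 2 := sqr_ge0 _.
  nra.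
apply: (le_trans xn).
have -> : (x ^+ 2) ^+ n = (4 * s ^+ 2) ^+ n * y ^+ n.
  by rewrite -exprMn /y mulrC divfK// gt_eqF.
rewrite /K [leRHS]mulrDl mul1r -[in leRHS]mulrA lerD//.
  by apply: le_trans (expR_ge1Dx y); rewrite lerDl.
by apply: ler_wpM2l; [exact/exprn_ge0/ltW|exact: exprn_le_fact_expR].
Qed.

Lemma measurable_normal_moment (s : R) n :
  measurable_fun setT (fun x => normal_pdf 0 s x * x ^+ n).
Proof.
apply: measurable_funM; last exact: measurable_funX.
exact: measurable_normal_pdf.
Qed.

Lemma integrable_normal_moment (s : R) n : s != 0 ->
  mu.-integrable setT (fun x => (normal_pdf 0 s x * x ^+ n)%:E).
Proof.
move=> s0; have [C [C0 HC]] := normal_pdf_dominated n s0.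
have := integrableZl measurableT C (integrable_normal_pdf 0 (Num.sqrt 2 * s)).
apply: le_integrable => //.
  by apply/measurable_EFinP; exact: measurable_normal_moment.
move=> x _; rewrite /= lee_fin normrM [leRHS]ger0_norm; last first.
  by rewrite mulr_ge0// normal_pdf_ge0.
by rewrite ger0_norm ?normal_pdf_ge0// normrX mulrC.
Qed.

(** Boundary terms of the integration by parts: domination at power [n + 1] leaves a factor
    [1 / (k + 1)]. The sequence [u] covers both ends [k + 1] and [- (k + 1)]. *)
Lemma cvg_normal_moment (s : R) n (u : nat -> R) : s != 0 ->
  (forall k, `|u k| = k.+1%:R) ->
  normal_pdf 0 s (u k) * u k ^+ n @[k --> \oo] --> (0 : R).
Proof.
move=> s0 uk; have [C [C0 HC]] := normal_pdf_dominated n.+1 s0.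
set s2 := Num.sqrt 2 * s in HC.
have s20 : s2 != 0 by rewrite mulf_neq0// gt_eqF// sqrtr_gt0.
apply/norm_cvg0P.
apply: (@squeeze_cvgr _ _ _ _ (cst 0) (fun k => C * normal_peak s2 * harmonic k)).
- near=> k; rewrite normr_ge0/= /harmonic ler_pdivlMr//.
  rewrite -uk normrM ger0_norm ?normal_pdf_ge0// -mulrA -normrM mulrC -exprSr normrX.
  apply: (le_trans (HC _)); rewrite ler_wpM2l//; exact: normal_pdf_ub.
- exact: cvg_cst.
- rewrite -(mulr0 (C * normal_peak s2)); apply: cvgMr; exact: cvg_harmonic.
Unshelve. all: by end_near. Qed.

(** Fundamental theorem on [[-(k+1), k+1]], then dominated convergence with bound [|f|]. The shift
    by one keeps every interval nondegenerate. *)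
Lemma integral_derive_eq0 (F f : R -> R) :
  (forall x : R, is_derive x 1 F (f x)) ->
  continuous f -> mu.-integrable setT (EFin \o f) ->
  F (k.+1%:R) @[k --> \oo] --> (0 : R) -> F (- k.+1%:R) @[k --> \oo] --> (0 : R) ->
  (\int[mu]_x (f x)%:E = 0)%E.
Proof.
move=> dF cf intf Fp Fn.
pose I k : set R := [set` `[(- k.+1%:R : R), k.+1%:R]].
have mI k : measurable (I k) by exact: measurable_itv.
pose g k : R -> \bar R := (EFin \o f) \_ (I k).
have mf : measurable_fun setT (EFin \o f) by case/integrableP: intf.
have [_ _ H] : [/\ mu.-integrable setT (EFin \o f),
    [sequence \int[mu]_x `|g n x - (f x)%:E|]_n @ \oo --> 0%E &
    [sequence \int[mu]_x g n x]_n @ \oo --> \int[mu]_x (f x)%:E]%E.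
  apply: (@dominated_convergence _ _ _ mu setT measurableT g
    (EFin \o f) (abse \o (EFin \o f))) => //.
  - by move=> n; apply/(measurable_restrictT _ (mI n)); exact: measurable_funTS.
  - apply: aeW => x _; apply: cvg_near_cst.
    near=> n; rewrite /g patchE mem_set// /I /= in_itv/= -ler_norml.
    apply: (@le_trans _ _ n%:R); last by rewrite ler_nat.
    near: n; exact: nbhs_infty_ger.
  - exact: integrable_abse.
  - apply: aeW => x n _; rewrite /g patchE; case: ifP => _ //=.
    by rewrite lee_fin normr0.
have E n : (\int[mu]_x g n x = (F n.+1%:R - F (- n.+1%:R))%:E)%E.
  rewrite -integral_mkcond (@continuous_FTC2 _ f F).
  - by rewrite EFinB.
  - by rewrite -subr_gt0 opprK addr_gt0.
  - exact: continuous_subspaceT.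
  - have cF x : {for x, continuous F}.
      apply: differentiable_continuous; apply/derivable1_diffP.
      by have := dF x; case.
    split.
    + by move=> x _; have := dF x; case.
    + by apply: cvg_at_right_filter; exact: cF.
    + by apply: cvg_at_left_filter; exact: cF.
  - by move=> x _; rewrite derive1E; exact: derive_val.
have H0 : (F n.+1%:R - F (- n.+1%:R))%:E @[n --> \oo] --> (0 - 0 : R)%:E.
  by apply: cvg_EFin; [exact: nearW|exact: cvgB].
move: H; rewrite /=; under eq_fun do rewrite E; move=> H.
by rewrite (cvg_unique _ H H0) ?subr0//; exact: ereal_hausdorff.
Unshelve. all: by end_near. Qed.

(** The density satisfies [phi' = - x phi / s^2]. At [n = 0] the truncated predecessor [n.-1] is
    multiplied by 0. *)
Lemma is_derive_normal_moment (s : R) n (x : R) : s != 0 ->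
  is_derive x 1 (fun x => normal_pdf 0 s x * x ^+ n)
    (n%:R * (normal_pdf 0 s x * x ^+ n.-1)
       - (s ^+ 2)^-1 * (normal_pdf 0 s x * x ^+ n.+1)).
Proof.
move=> s0; rewrite (normal_pdfE 0 s0).
have d1 := is_deriveZ (- (2 * s ^+ 2)^-1) (is_deriveX 2 (is_derive_id x 1)).
have d2 := is_derive1_comp (is_derive_expR _) d1.
have d3 := is_deriveM (is_deriveZ (normal_peak s) d2) (is_deriveX n (is_derive_id x 1)).
have -> : (fun x => normal_peak s * normal_fun 0 s x * x ^+ n) =
   (normal_peak s \*: (expR \o (- (2 * s ^+ 2)^-1 \*: (@id R) ^+ 2))) * (@id R) ^+ n.
  apply/funext => y; rewrite /normal_fun subr0 !fctE.
  rewrite -[RHS]/(normal_peak s * expR (- (2 * s ^+ 2)^-1 * y ^+ 2) * y ^+ n).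
  by congr (_ * expR _ * _); rewrite -mulr_natr; field.
apply: (is_derive_eq d3); rewrite !fctE.
have -> : normal_fun 0 s x = expR (- (2 * s ^+ 2)^-1 * x ^+ 2).
  by rewrite /normal_fun subr0; congr expR; rewrite -mulr_natr; field.
set E := expR _.
rewrite -[LHS]/(normal_peak s * E * (n%:R * x ^+ n.-1 * 1) +
  x ^+ n * (normal_peak s * (E * (- (2 * s ^+ 2)^-1 * (2%:R * x ^+ 1 * 1))))).
rewrite [x ^+ n.+1]exprS expr1.
set u := x ^+ n; set v := x ^+ n.-1; set p := normal_peak s.
by field.
Qed.

(** Moments of N(0,1): the double factorial [(n-1)!!] for even [n], and 0 for odd [n]. *)
Fixpoint std_normal_moment (n : nat) : nat :=
  match n with 0 => 1 | 1 => 0 | m.+2 => m.+1 * std_normal_moment m end.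

(** Gaussian integration by parts: the derivative of [phi x^n] integrates to 0. *)
Lemma integral_normal_moment_rec (s : R) n : s != 0 ->
  (\int[mu]_x (normal_pdf 0 s x * x ^+ n.+1)%:E =
   (s ^+ 2 * n%:R)%:E * \int[mu]_x (normal_pdf 0 s x * x ^+ n.-1)%:E)%E.
Proof.
move=> s0; pose M k x := normal_pdf 0 s x * x ^+ k.
have iM k : mu.-integrable setT (EFin \o M k) := integrable_normal_moment k s0.
have iZ k c : mu.-integrable setT (EFin \o (fun x => c * M k x)).
  exact: (integrableZl measurableT c (iM k)).
have E0 : (\int[mu]_x (n%:R * M n.-1 x - (s ^+ 2)^-1 * M n.+1 x)%:E = 0)%E.
  apply: (@integral_derive_eq0 (M n)).
  - by move=> x; exact: is_derive_normal_moment.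
  - have cM k : continuous (M k).
      move=> x; apply: cvgM; first exact: continuous_normal_pdf.
      exact: exprn_continuous.
    by move=> x; apply: cvgB; (apply: cvgM; [exact: cvg_cst|exact: cM]).
  - have := integrableB measurableT (iZ n.-1 n%:R) (iZ n.+1 (s ^+ 2)^-1).
    by apply: eq_integrable => // x _; rewrite /= EFinB.
  - by apply: cvg_normal_moment => // k; rewrite ger0_norm.
  - by apply: cvg_normal_moment => // k; rewrite normrN ger0_norm.
move: E0; under eq_integral do rewrite EFinB.
rewrite integralB_EFin//.
have EZ k c : (\int[mu]_x (c * M k x)%:E = c%:E * \int[mu]_x (M k x)%:E)%E.
  by rewrite -(integralZl measurableT (iM k)); apply: eq_integral => x _; rewrite EFinM.
rewrite !EZ.
have fM k : (\int[mu]_x (M k x)%:E)%E \is a fin_num.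
  exact: (integrable_fin_num measurableT (iM k)).
rewrite -(fineK (fM n.-1)) -(fineK (fM n.+1)) -!EFinM -EFinB => -[/eqP].
set a := fine _; set b := fine _; rewrite subr_eq0 => /eqP ab.
congr EFin; rewrite -mulrA ab mulrA divff ?mul1r//.
by rewrite expf_neq0.
Qed.

Lemma integral_normal_moment (s : R) n : s != 0 ->
  (\int[mu]_x (normal_pdf 0 s x * x ^+ n)%:E = (s ^+ n * (std_normal_moment n)%:R)%:E)%E.
Proof.
move=> s0; elim/ltn_ind: n => -[|[|n]] IH.
- under eq_integral do rewrite expr0 mulr1.
  by rewrite integral_normal_pdf expr0 mul1r.
- by rewrite integral_normal_moment_rec// mulr0 mul0e mulr0.
- rewrite integral_normal_moment_rec//= IH// -EFinM; congr EFin.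
  by rewrite natrM !exprS; ring.
Qed.

(** Transfer to the image law: the Dirac mass at 0 when [s = 0], Lebesgue measure weighted by the
    density otherwise. *)
Lemma gaussian_moment d (T : measurableType d) (P : probability T R)
    (Z : T -> R) (s : R) n :
  measurable_fun setT Z ->
  (forall A, measurable A -> P (Z @^-1` A) = gauss_law s A) ->
  has_expectation P (fun w => Z w ^+ n) (s ^+ n * (std_normal_moment n)%:R).
Proof.
move=> mZ lawZ.
have PE A : measurable A -> (\int[P]_w (cst 1 w * \1_A (Z w))%:E = P (Z @^-1` A))%E.
  move=> mA; under eq_integral do rewrite /= mul1r.
  rewrite (_ : (fun w => _) = fun w => (\1_(Z @^-1` A) w)%:E)//.
  rewrite integral_indic ?setIT// -[X in measurable X]setTI.
  exact: mZ.
have mXn : measurable_fun setT (fun x : R => x ^+ n) by exact: measurable_funX.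
have [s0|s0] := eqVneq s 0.
  have m1Xn : measurable_fun setT (fun x : R => (cst 1 x * x ^+ n)%:E).
    by apply/measurable_EFinP; exact: measurable_funM.
  have [iZ eZ] : P.-integrable setT (fun w => (cst 1 w * Z w ^+ n)%:E) /\
      (\int[P]_w (cst 1 w * Z w ^+ n)%:E =
       \int[dirac (0%R : R)]_x (cst 1 x * x ^+ n)%:E)%E.
    apply: (@weighted_transfer_integrable _ _ _ _ R P (dirac (0%R : R))
      (cst 1) Z (cst 1) id _ _ _ _ _ _ _ (fun x => x ^+ n)) => //.
    - move=> A mA; rewrite PE// lawZ// /gauss_law s0 eqxx.
      under eq_integral do rewrite /= mul1r.
      by rewrite integral_indic// setIT.
    - apply/integrableP; split; first exact: m1Xn.
      rewrite integral_dirac//; last exact: measurableT_comp.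
      by rewrite diracT mul1e ltry.
  split; first by move: iZ; apply: eq_integrable => // w _; rewrite /= mul1r.
  transitivity (\int[P]_w (cst 1 w * Z w ^+ n)%:E)%E.
    by apply: eq_integral => w _; rewrite /= mul1r.
  rewrite eZ integral_dirac//=.
  rewrite diracT mul1e mul1r s0.
  (* The convention [0 ^+ 0 = 1] matches the zeroth moment; higher powers vanish on both sides. *)
  by case: n {mXn m1Xn iZ eZ} => [|n]; rewrite ?expr0 ?mul1r// !expr0n/= mul0r.
have [iZ eZ] : P.-integrable setT (fun w => (cst 1 w * Z w ^+ n)%:E) /\
    (\int[P]_w (cst 1 w * Z w ^+ n)%:E = \int[mu]_x (normal_pdf 0 s x * x ^+ n)%:E)%E.
  apply: (@weighted_transfer_integrable _ _ _ _ R P mu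
    (cst 1) Z (normal_pdf 0 s) id _ _ _ _ _ _ _ (fun x => x ^+ n)) => //.
  - exact: measurable_normal_pdf.
  - by move=> x; exact: normal_pdf_ge0.
  - move=> A mA; rewrite PE// lawZ// /gauss_law (negbTE s0) /normal_prob.
    rewrite [LHS]integral_mkcond; apply: eq_integral => x _.
    by rewrite patchE indicE; case: ifP => _; rewrite ?mulr1 ?mulr0.
  - exact: integrable_normal_moment.
split; first by move: iZ; apply: eq_integrable => // w _; rewrite /= mul1r.
rewrite -integral_normal_moment// -eZ.
by apply: eq_integral => w _; rewrite /= mul1r.
Qed.

End gaussian_moments.

(** * Lower bounds for the spectral norm *)

Section spec_norm_lower_bounds.
Context {R : realType}.

(** Cauchy-Schwarz, read off from the nonnegative sum of [(r u_i - v_i)^2] with [r] the norm of [v];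
    [r = 0] is separate because a factor [r] is cancelled at the end. *)
Lemma sum_mul_le_sqrt n (u v : 'I_n -> R) : \sum_i u i ^+ 2 <= 1 ->
  \sum_i u i * v i <= Num.sqrt (\sum_i v i ^+ 2).
Proof.
move=> u1; set S := \sum_i v i ^+ 2; set r := Num.sqrt S.
have S0 : 0 <= S by apply: sumr_ge0 => i _; exact: sqr_ge0.
have rr : r ^+ 2 = S by rewrite sqr_sqrtr.
have r0 : 0 <= r := sqrtr_ge0 S.
have [r_eq0|r_neq0] := eqVneq r 0.
  have v0 i : v i = 0.
    apply/eqP; rewrite -sqrf_eq0; apply/eqP.
    apply: (psumr_eq0P (P := predT) (F := fun i => v i ^+ 2)) => //.
      by move=> j _; exact: sqr_ge0.
    by rewrite -/S -rr r_eq0 expr0n.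
  by rewrite big1 ?r0// => i _; rewrite v0 mulr0.
have : 0 <= \sum_i (r * u i - v i) ^+ 2 by apply: sumr_ge0 => i _; exact: sqr_ge0.
have -> : \sum_i (r * u i - v i) ^+ 2 =
    r ^+ 2 * \sum_i u i ^+ 2 - 2 * r * (\sum_i u i * v i) + r ^+ 2.
  rewrite rr !mulr_sumr -sumrB -big_split/=.
  by apply: eq_bigr => i _; rewrite -rr; ring.
have r_gt0 : 0 < r by rewrite lt_neqAle eq_sym r_neq0.
move: u1; set a := \sum_i u i ^+ 2; set b := \sum_i u i * v i => u1 H.
have : r ^+ 2 * a <= r ^+ 2 by rewrite ler_piMr// sqr_ge0.
rewrite -(ler_pM2l r_gt0); nra.
Qed.

(** Cauchy-Schwarz on one row; summed over rows, it bounds the set whose supremum is [spec_norm]. *)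
Lemma mulmx_sqr_le n m (M : 'M[R]_(n, m)) (x : 'cV[R]_m) i :
  \sum_j x j ord0 ^+ 2 <= 1 -> ((M *m x) i ord0) ^+ 2 <= \sum_j M i j ^+ 2.
Proof.
move=> x1; have S0 : 0 <= \sum_j M i j ^+ 2 by apply: sumr_ge0 => j _; exact: sqr_ge0.
rewrite -[leRHS]sqr_sqrtr// -[leLHS]real_normK ?num_real//.
rewrite lerXn2r ?nnegrE ?sqrtr_ge0// mxE ler_norml; apply/andP; split.
  rewrite lerNl -sumrN.
  have := @sum_mul_le_sqrt _ (fun j => - x j ord0) (fun j => M i j).
  under eq_bigr do rewrite sqrrN.
  move=> /(_ x1); apply: le_trans; apply: ler_sum => j _.
  by rewrite mulNr mulrC.
have := @sum_mul_le_sqrt _ (fun j => x j ord0) (fun j => M i j).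
by move=> /(_ x1); apply: le_trans; apply: ler_sum => j _; rewrite mulrC.
Qed.

Lemma spec_norm_ge n m (M : 'M[R]_(n, m)) (u : 'I_n -> R) (x : 'cV[R]_m) :
  \sum_i u i ^+ 2 <= 1 -> \sum_j x j ord0 ^+ 2 <= 1 ->
  \sum_i u i * (M *m x) i ord0 <= spec_norm M.
Proof.
move=> u1 x1; apply: le_trans (sum_mul_le_sqrt _ u1) _.
apply: sup_upper_bound; last by exists x.
split; first by exists (Num.sqrt (\sum_i ((M *m x) i ord0) ^+ 2)), x.
(* The Frobenius norm is an upper bound, so that [sup] is a genuine supremum and not its default
   value. *)
exists (Num.sqrt (\sum_i \sum_j M i j ^+ 2)) => _ [y /= y1 <-].
rewrite ler_sqrt; last by do 2!(apply: sumr_ge0 => ? _); exact: sqr_ge0.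
by apply: ler_sum => i _; exact: mulmx_sqr_le.
Qed.

Lemma spec_norm_ge0 n m (M : 'M[R]_(n, m)) : 0 <= spec_norm M.
Proof.
have u0 : \sum_(i < n) (0 : R) ^+ 2 <= 1 by rewrite big1// => i _; rewrite expr2 mul0r.
have x0 : \sum_j (0 : 'cV[R]_m) j ord0 ^+ 2 <= 1.
  by rewrite big1// => j _; rewrite mxE expr2 mul0r.
by have := spec_norm_ge M u0 x0; rewrite big1// => i _; rewrite mul0r.
Qed.

(** An inequality, not an equality, so as to cover [p = 0] and sign vectors with zero entries. *)
Lemma sum_sqr_div_sqrt_le1 p (s : 'I_p -> R) :
  (forall i, s i ^+ 2 <= 1) -> \sum_i (s i / Num.sqrt p%:R) ^+ 2 <= 1.
Proof.
move=> s1; have [p0|p0] := eqVneq p 0%N.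
  by rewrite big1// => i; have := ltn_ord i; rewrite {2}p0.
under eq_bigr do rewrite exprMn exprVn sqr_sqrtr//.
rewrite -mulr_suml ler_pdivrMr ?ltr0n ?lt0n// mul1r.
apply: le_trans (ler_sum _ (fun i _ => s1 i)) _.
by rewrite sumr_const card_ord.
Qed.

(** Test [M] on the basis vector [e_j] and pair the result with the normalized signs of that
    column. *)
Lemma spec_norm_ge_sum_norm_col p (M : 'M[R]_p) j :
  (Num.sqrt p%:R)^-1 * \sum_i `|M i j| <= spec_norm M.
Proof.
have u1 : \sum_i (Num.sg (M i j) / Num.sqrt p%:R) ^+ 2 <= 1.
  by apply: sum_sqr_div_sqrt_le1 => i; rewrite sqr_sg; case: (_ != _).
have x1 : \sum_k (delta_mx j 0 : 'cV[R]_p) k ord0 ^+ 2 <= 1.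
  rewrite (bigD1 j)//= big1 ?addr0 => [|k /negbTE kj]; rewrite mxE ?kj ?eqxx//=.
  by rewrite expr2 mulr0.
apply: le_trans _ (spec_norm_ge M u1 x1).
rewrite mulr_sumr ler_sum// => i _; rewrite -colE mxE normrEsg.
by rewrite le_eqVlt; apply/orP; left; apply/eqP; ring.
Qed.

(** Test with the same vector [s / sqrt p] on both sides. *)
Lemma spec_norm_ge_sign_form p (M : 'M[R]_p) (s : 'I_p -> R) :
  (forall i, s i ^+ 2 <= 1) ->
  p%:R^-1 * \sum_i \sum_k s i * s k * M i k <= spec_norm M.
Proof.
move=> s1; pose x : 'cV[R]_p := \col_k (s k / Num.sqrt p%:R).
have x1 : \sum_k x k ord0 ^+ 2 <= 1.
  by under eq_bigr do rewrite mxE; exact: sum_sqr_div_sqrt_le1.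
apply: le_trans _ (spec_norm_ge M (sum_sqr_div_sqrt_le1 s1) x1).
rewrite mulr_sumr ler_sum// => i _; rewrite mxE !mulr_sumr ler_sum// => k _.
rewrite mxE -[X in X^-1 * _](@sqr_sqrtr _ p%:R)// expr2 invfM.
by rewrite le_eqVlt; apply/orP; left; apply/eqP; ring.
Qed.

End spec_norm_lower_bounds.

(** * First absolute moment of a sum of independent variables *)

Section sums_of_independent.
Context d (T : measurableType d) (R : realType) (P : probability T R).

(* |x| >= x^2/a - x^4/(4a^3) for every a > 0; taken in expectation with
   a = 3 sqrt (E x^2). *)
Lemma expect_norm_ge_sqrt (S : T -> R) (v m q : R) :
  has_expectation P S v ->
  has_expectation P (fun w => S w ^+ 2) m ->
  has_expectation P (fun w => S w ^+ 4) q ->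
  q <= 15 * m ^+ 2 ->
  7 / 36 * Num.sqrt m <= expect P (fun w => `|S w|).
Proof.
move=> eS eS2 eS4 qm; have eN := has_expectation_norm eS.
have m0 : 0 <= m.
  by apply: (le_has_expectation (has_expectation_cst P 0) eS2) => w; exact: sqr_ge0.
have [m_eq0|m_neq0] := eqVneq m 0.
  rewrite m_eq0 sqrtr0 mulr0.
  by apply: (le_has_expectation (has_expectation_cst P 0) eN) => w.
set r := Num.sqrt m.
have r0 : 0 < r by rewrite sqrtr_gt0 lt_neqAle eq_sym m_neq0.
have rr : m = r ^+ 2 by rewrite sqr_sqrtr.
have [a [aE a0]] : exists a, a = 3 * r /\ 0 < a by exists (3 * r); rewrite mulr_gt0.
have := has_expectationB (has_expectationZ a^-1 eS2) (has_expectationZ (4 * a ^+ 3)^-1 eS4).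
move=> /le_has_expectation /(_ eN) H.
apply: le_trans (H _); last first.
  move=> w; set t := `|S w|.
  have -> : S w ^+ 4 = (S w ^+ 2) ^+ 2 by rewrite -exprM.
  rewrite -(real_normK (num_real (S w))) -/t.
  have t0 : 0 <= t := normr_ge0 _.
  have -> : a^-1 * t ^+ 2 - (4 * a ^+ 3)^-1 * (t ^+ 2) ^+ 2 =
      (4 * a ^+ 2 * t ^+ 2 - (t ^+ 2) ^+ 2) / (4 * a ^+ 3) by field; rewrite gt_eqF.
  rewrite ler_pdivrMr ?mulr_gt0 ?exprn_gt0//.
  have -> : t * (4 * a ^+ 3) = t * (a * (4 * a ^+ 2)) by ring.
  suff : 0 <= t * (4 * a ^+ 3 - 4 * a ^+ 2 * t + t ^+ 3) by nra.
  rewrite mulr_ge0//.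
  (* Positivity certificate for [t >= 0]: [7/6] approximates the minimizer [2 / sqrt 3] (in units of
     [a]), [7/3] cancels the quadratic term, and the remainders are nonnegative. *)
  have -> : 4 * a ^+ 3 - 4 * a ^+ 2 * t + t ^+ 3 =
    (t + 7 / 3 * a) * (t - 7 / 6 * a) ^+ 2 + a ^+ 2 * t / 12 + 89 / 108 * a ^+ 3 by field.
  have aw := ltW a0; apply: addr_ge0; last by rewrite mulr_ge0// exprn_ge0.
  apply: addr_ge0; first by rewrite mulr_ge0 ?sqr_ge0// addr_ge0// mulr_ge0.
  by rewrite !mulr_ge0// sqr_ge0.
rewrite [_^-1 * q]mulrC.
have : q / (4 * a ^+ 3) <= 15 * m ^+ 2 / (4 * a ^+ 3).
  by rewrite ler_wpM2r// invr_ge0 mulr_ge0// exprn_ge0// ltW.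
(* With [a = 3 r] the two terms are [r/3] and at most [5r/36]; their difference gives the constant
   [7/36]. *)
have -> : 15 * m ^+ 2 / (4 * a ^+ 3) = 5 / 36 * r.
  by rewrite rr aE; field; rewrite gt_eqF.
have -> : a^-1 * m = 3^-1 * r by rewrite rr aE; field; rewrite gt_eqF.
set x := q / _; lra.
Qed.

(** * Moments of a sum from factorizing mixed moments *)

Section moments.
Context (J : finType) (Y : J -> T -> R) (mom : J -> nat -> R).
Hypothesis prodY : forall b : J -> nat,
  has_expectation P (fun w => \prod_j Y j w ^+ b j) (\prod_j mom j (b j)).

(** The [a]-th moment of a sum of independent variables, one variable at a time by the binomial
    theorem. *)
Fixpoint sum_mom (s : seq J) (a : nat) : R :=
  if s is j :: s' then \sum_(i < a.+1) (mom j (a - i) * sum_mom s' i) *+ 'C(a, i)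
  else (a == 0)%:R.

(* Carrying the monomial in the remaining variables through the induction
   replaces the independence of partial sums from the next variable. *)
Lemma has_expectation_sumX_prod (s : seq J) a (b : J -> nat) : uniq s ->
  has_expectation P
    (fun w => (\sum_(j <- s) Y j w) ^+ a * \prod_(j | j \notin s) Y j w ^+ b j)
    (sum_mom s a * \prod_(j | j \notin s) mom j (b j)).
Proof.
elim: s a b => [|j s IHs] a b /=.
  move=> _; apply: eq_has_expectation (has_expectationZ (a == 0)%:R (prodY b)).
  by move=> w; rewrite big_nil expr0n.
move=> /andP[js us].
(* Each binomial term moves a power of [Y j] into the monomial, where the induction hypothesis
   absorbs it as the exponent [c] of [j]. *)
pose b' c l := if l == j then c else b l.
have split_prod (V : comRingType) (F : J -> nat -> V) c :
    \prod_(l | l \notin s) F l (b' c l) =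
    F j c * \prod_(l | l \notin j :: s) F l (b l).
  rewrite (bigD1 j)//= /b' eqxx; congr (_ * _).
  rewrite (eq_bigl (fun l => l \notin j :: s)).
    by apply: eq_bigr => l; rewrite inE negb_or => /andP[/negbTE ->].
  by move=> l; rewrite inE negb_or andbC.
have H (i : 'I_a.+1) := has_expectationZ ('C(a, i)%:R) (IHs i (b' (a - i)%N) us).
have HS := has_expectation_sum (index_enum 'I_a.+1) (fun i (_ : true) => H i).
rewrite mulr_suml (eq_bigr (fun i : 'I_a.+1 => 'C(a, i)%:R *
    (sum_mom s i * \prod_(l | l \notin s) mom l (b' (a - i)%N l)))); last first.
  by move=> i _; rewrite (split_prod _ mom) -[_ *+ 'C(a, i)]mulr_natr; ring.
apply: (eq_has_expectation _ HS) => w; rewrite big_cons exprDn mulr_suml.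
apply: eq_bigr => i _; rewrite (split_prod _ (fun l c => Y l w ^+ c)).
by rewrite -[_ *+ 'C(a, i)]mulr_natr; ring.
Qed.

Lemma has_expectation_sumX a :
  has_expectation P (fun w => (\sum_j Y j w) ^+ a) (sum_mom (index_enum J) a).
Proof.
have := has_expectation_sumX_prod a (fun=> 0%N) (index_enum_uniq J).
rewrite big_pred0 ?mulr1; last by move=> j; rewrite mem_index_enum.
by apply: eq_has_expectation => w; rewrite big_pred0 ?mulr1// => j; rewrite mem_index_enum.
Qed.

Hypothesis mom0 : forall j, mom j 0 = 1.
Hypothesis mom1 : forall j, mom j 1 = 0.

Lemma sum_mom0 s : sum_mom s 0 = 1.
Proof.
elim: s => //= j s IHs; rewrite big_ord_recl big_ord0 /= IHs subnn mom0 bin0.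
by rewrite mulr1n mulr1 addr0.
Qed.

Lemma sum_mom1 s : sum_mom s 1 = 0.
Proof.
elim: s => //= j s IHs; rewrite !big_ord_recl big_ord0 /= sum_mom0 IHs mom1.
by rewrite mul0r mulr0 !mul0rn !addr0.
Qed.

Lemma sum_mom2 s : sum_mom s 2 = \sum_(j <- s) mom j 2.
Proof.
elim: s => [|j s IHs] /=; first by rewrite big_nil.
rewrite !big_ord_recl big_ord0 big_cons /= sum_mom0 sum_mom1 IHs mom0 /bump/=.
by rewrite mulr0 mul0rn mulr1 mul1r !mulr1n addr0 add0r.
Qed.

(** Vanishing first moments leave [E Y^4 + 6 E Y^2 E S^2 + E S^4], and the cross coefficient 6 is
    below the 30 coming from [15 (u + v)^2]. *)
Lemma sum_mom4_le s : (forall j, 0 <= mom j 2) ->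
  (forall j, mom j 4 <= 15 * mom j 2 ^+ 2) ->
  sum_mom s 4 <= 15 * (sum_mom s 2) ^+ 2.
Proof.
move=> v0 vq; elim: s => [|j s IHs]; first by rewrite /= expr0n mulr0.
have := vq j; have := v0 j.
have : 0 <= sum_mom s 2 by rewrite sum_mom2 sumr_ge0.
have -> : sum_mom (j :: s) 2 = mom j 2 + sum_mom s 2.
  by rewrite !sum_mom2 big_cons.
have -> : sum_mom (j :: s) 4 = mom j 4 + 6 * (mom j 2 * sum_mom s 2) + sum_mom s 4.
  rewrite /= !big_ord_recl big_ord0 /= /bump/= sum_mom0 sum_mom1 mom0 mom1.
  rewrite (_ : 'C(4, 2) = 6)//.
  by rewrite !mulr0 !mul0r !mul0rn mulr1 mul1r !mulr1n !addr0 !add0r -mulr_natl addrA.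
move: IHs; nra.
Qed.

Lemma expect_norm_sum_ge : (forall j, 0 <= mom j 2) ->
  (forall j, mom j 4 <= 15 * mom j 2 ^+ 2) ->
  has_expectation P (fun w => `|\sum_j Y j w|) (expect P (fun w => `|\sum_j Y j w|)) /\
  7 / 36 * Num.sqrt (\sum_j mom j 2) <= expect P (fun w => `|\sum_j Y j w|).
Proof.
move=> v0 vq; have e1 := has_expectation_sumX 1.
split; first exact: has_expectation_norm e1.
rewrite -sum_mom2.
exact: expect_norm_ge_sqrt e1 (has_expectation_sumX 2) (has_expectation_sumX 4)
  (sum_mom4_le _ v0 vq).
Qed.

End moments.
End sums_of_independent.

(** * Gaussian matrices with independent entries *)

(** Here [F] will be the spectral norm, whose measurability is not established: the integral of a
    nonnegative function is a supremum over simple functions below it, hence monotone. As [G] may be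
    negative, its positive part is interposed. *)
Lemma has_expectation_le_integral d (T : measurableType d) (R : realType)
    (P : probability T R) (F G : T -> R) v :
  has_expectation P G v -> (forall w, 0 <= F w) -> (forall w, G w <= F w) ->
  (v%:E <= \int[P]_w (F w)%:E)%E.
Proof.
move=> eG F0 GF; have mG := has_expectation_measurable eG.
have [iG eqG] := eG; rewrite -eqG.
apply: (@le_trans _ _ (\int[P]_w (Num.max (G w) 0)%:E)%E).
  apply: le_integral => //.
    apply: (@le_integrable _ _ _ P setT measurableT _ (EFin \o G)) => //.
      by apply/measurable_EFinP; exact: measurable_maxr.
    move=> w _; rewrite /= lee_fin; case: (leP (G w) 0) => Gw.
      by rewrite normr0.
    by [].
  by move=> w _; rewrite lee_fin le_max lexx.
have max0 w : (0 <= (Num.max (G w) 0)%:E)%E by rewrite lee_fin le_max lexx orbT.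
have F0' w : (0 <= (F w)%:E)%E by rewrite lee_fin.
rewrite !ge0_integralTE//; apply: le_ereal_sup => _ [h /= hG <-].
exists h => //= w; apply: (le_trans (hG w)).
by rewrite lee_fin ge_max GF F0.
Qed.

Section gaussian_matrix.
Context d (T : measurableType d) (R : realType) (P : probability T R).
Context (p1 p2 : nat) (sigma : 'I_p2 -> R) (Z : T -> 'M[R]_(p1, p2)).
Hypothesis mZ : entries_measurable Z.
Hypothesis indZ : entries_independent P Z.
Hypothesis lawZ : forall (i : 'I_p1) (j : 'I_p2) (A : set R), borel_set A ->
  P [set w | A (Z w i j)] = gauss_law (sigma j) A.

Lemma entries_prod (f : 'I_p1 -> 'I_p2 -> R -> R) (v : 'I_p1 -> 'I_p2 -> R) :
  (forall i j, measurable_fun setT (f i j)) ->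
  (forall i j, has_expectation P (fun w => f i j (Z w i j)) (v i j)) ->
  has_expectation P (fun w => \prod_i \prod_j f i j (Z w i j))
    (\prod_i \prod_j v i j).
Proof.
move=> mf fv.
have := @indep_prod _ _ _ P ('I_p1 * 'I_p2)%type (fun k w => Z w k.1 k.2) _ _
  (fun k => f k.1 k.2) (fun k => v k.1 k.2).
rewrite -(pair_bigA _ v) => H; apply: eq_has_expectation (H _ _ _ _) => //.
- by move=> w; rewrite -(pair_bigA _ (fun i j => f i j (Z w i j))).
- move=> A mA.
  rewrite (eq_bigr (fun k => P ((fun w => Z w k.1 k.2) @^-1` A (k.1, k.2)))); last by case.
  rewrite -(pair_bigA _ (fun i j => P ((fun w => Z w i j) @^-1` A (i, j)))).
  rewrite -(indZ (A := fun i j => A (i, j)))//; congr (P _).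
  by apply/seteqP; split=> w /= H' => [i j|[i j]]; [exact: (H' (i, j))|exact: H'].
Qed.

(** All entries outside the two rows receive the constant factor 1. *)
Lemma two_rows_prod (i k : 'I_p1) (g h : 'I_p2 -> R -> R) (u v : 'I_p2 -> R) :
  i != k ->
  (forall j, measurable_fun setT (g j)) -> (forall j, measurable_fun setT (h j)) ->
  (forall j, has_expectation P (fun w => g j (Z w i j)) (u j)) ->
  (forall j, has_expectation P (fun w => h j (Z w k j)) (v j)) ->
  has_expectation P
    (fun w => (\prod_j g j (Z w i j)) * \prod_j h j (Z w k j))
    ((\prod_j u j) * \prod_j v j).
Proof.
move=> ik mg mh gu hv.
pose f a := if a == i then g else if a == k then h else fun=> cst 1.
pose y a := if a == i then u else if a == k then v else fun=> 1.
have ki : (k == i) = false by rewrite eq_sym; exact: negbTE.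
have split_rows (F : 'I_p1 -> R) : (forall a, a != i -> a != k -> F a = 1) ->
    \prod_a F a = F i * F k.
  move=> F1; rewrite (bigD1 i)//= (bigD1 k)/= ?ki// big1 ?mulr1// => a /andP[].
  exact: F1.
have := @entries_prod f y; rewrite split_rows; last first.
  by move=> a /negbTE ai /negbTE ak; rewrite /y ai ak big1.
rewrite /y eqxx ki eqxx => H; apply: eq_has_expectation (H _ _).
- move=> w; rewrite split_rows /f ?eqxx ?ki ?eqxx// => a /negbTE ai /negbTE ak.
  by rewrite ai ak big1.
- by move=> a j; rewrite /f; do 2!case: ifP => _ //.
- move=> a j; rewrite /f; case: eqP => [->|_]; first exact: gu.
  case: eqP => [->|_]; first exact: hv.
  exact: has_expectation_cst.
Qed.

Lemma row_prod (i : 'I_p1) (g : 'I_p2 -> R -> R) (u : 'I_p2 -> R) :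
  (forall j, measurable_fun setT (g j)) ->
  (forall j, has_expectation P (fun w => g j (Z w i j)) (u j)) ->
  has_expectation P (fun w => \prod_j g j (Z w i j)) (\prod_j u j).
Proof.
move=> mg gu.
pose f a := if a == i then g else fun=> cst 1.
pose y a := if a == i then u else fun=> 1.
have split_rows (F : 'I_p1 -> R) : (forall a, a != i -> F a = 1) ->
    \prod_a F a = F i.
  by move=> F1; rewrite (bigD1 i)//= big1 ?mulr1.
have := @entries_prod f y; rewrite split_rows; last first.
  by move=> a /negbTE ai; rewrite /y ai big1.
rewrite /y eqxx => H; apply: eq_has_expectation (H _ _).
- move=> w; rewrite split_rows /f ?eqxx// => a /negbTE ai.
  by rewrite ai big1.
- by move=> a j; rewrite /f; case: ifP => _ //.
- move=> a j; rewrite /f; case: eqP => [->|_]; first exact: gu.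
  exact: has_expectation_cst.
Qed.

Lemma entry_moment i j n :
  has_expectation P (fun w => Z w i j ^+ n) (sigma j ^+ n * (std_normal_moment n)%:R).
Proof.
by apply: (@gaussian_moment _ _ _ P (fun w => Z w i j)) => //; exact: lawZ.
Qed.

(** Moments of [Z_ij Z_kj] for [i != k]: a square, since the two independent factors have the same
    law. *)
Let crossmom j b := (sigma j ^+ b * (std_normal_moment b)%:R) ^+ 2.
(** Moments of [Z_ij^2 - sigma_j^2], expanded by the binomial theorem. *)
Let diagmom j b :=
  \sum_(i < b.+1) (sigma j ^+ (2 * (b - i)) * (std_normal_moment (2 * (b - i)))%:R *
                   (- sigma j ^+ 2) ^+ i) *+ 'C(b, i).

Let cross_prod (i k : 'I_p1) (b : 'I_p2 -> nat) : i != k ->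
  has_expectation P (fun w => \prod_j (Z w i j * Z w k j) ^+ b j)
    (\prod_j crossmom j (b j)).
Proof.
move=> ik.
have mX j : measurable_fun setT (fun x : R => x ^+ b j) by exact: measurable_funX.
have := two_rows_prod ik mX mX (fun j => entry_moment i j (b j))
  (fun j => entry_moment k j (b j)).
rewrite -big_split/=; apply: eq_has_expectation => w.
by rewrite -big_split; apply: eq_bigr => j _; rewrite exprMn.
Qed.

Let diag_prod (i : 'I_p1) (b : 'I_p2 -> nat) :
  has_expectation P (fun w => \prod_j (Z w i j ^+ 2 - sigma j ^+ 2) ^+ b j)
    (\prod_j diagmom j (b j)).
Proof.
apply: (@row_prod i (fun j x => (x ^+ 2 - sigma j ^+ 2) ^+ b j)) => j.
  apply: measurable_funX; apply: measurable_funB => //; exact: measurable_funX.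
have H (l : 'I_(b j).+1) := has_expectationZ ((- sigma j ^+ 2) ^+ l *+ 'C(b j, l))
   (entry_moment i j (2 * (b j - l))).
have HS := has_expectation_sum (index_enum 'I_(b j).+1) (fun l (_ : true) => H l).
rewrite /diagmom (eq_bigr (fun l : 'I_(b j).+1 => (- sigma j ^+ 2) ^+ l *+ 'C(b j, l) *
  (sigma j ^+ (2 * (b j - l)) * (std_normal_moment (2 * (b j - l)))%:R))); last first.
  by move=> l _; rewrite mulrnAl mulrC.
apply: (eq_has_expectation _ HS) => w; rewrite exprDn.
by apply: eq_bigr => l _; rewrite mulrnAl mulrC exprM.
Qed.

Let diagmomE j : [/\ diagmom j 0 = 1, diagmom j 1 = 0,
  diagmom j 2 = 2 * sigma j ^+ 4 & diagmom j 4 = 60 * sigma j ^+ 8].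
Proof.
have g0 : std_normal_moment (2 * 0) = 1%N by [].
have g2 : std_normal_moment (2 * 1) = 1%N by [].
have g4 : std_normal_moment (2 * 2) = 3 by [].
have g6 : std_normal_moment (2 * 3) = 15 by [].
have g8 : std_normal_moment (2 * 4) = 105 by [].
have b42 : 'C(4, 2) = 6 by [].
have b43 : 'C(4, 3) = 4 by [].
(* Generalizing [std_normal_moment] keeps only the recorded values: [3 - 2 + 1 = 2] and
   [105 - 60 + 18 - 4 + 1 = 60]. *)
rewrite /diagmom; move: std_normal_moment g0 g2 g4 g6 g8 => g g0 g2 g4 g6 g8.
split; rewrite -(big_mkord predT (fun i => (sigma j ^+ (2 * (_ - i)) *
  (g (2 * (_ - i))%N)%:R * (- sigma j ^+ 2) ^+ i) *+ 'C(_, i)));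
  rewrite !big_nat_recr//= big_geq// !subnn ?subn0 g0 ?bin0 ?binn ?bin1.
- by ring.
- by rewrite g2; ring.
- by rewrite -[(2 - 1)%N]/1%N g2 g4; ring.
- by rewrite -[(4 - 1)%N]/3%N -[(4 - 2)%N]/2%N -[(4 - 3)%N]/1%N g2 g4 g6 g8 b42 b43; ring.
Qed.

Let centered w := Z w *m (Z w)^T - expect_mx P (fun w' => Z w' *m (Z w')^T).

Let gramE w i k : (Z w *m (Z w)^T) i k = \sum_j Z w i j * Z w k j.
Proof. by rewrite mxE; apply: eq_bigr => j _; rewrite mxE. Qed.

Let crossmom0 j : crossmom j 0 = 1.
Proof. by rewrite /crossmom expr0 mul1r expr1n. Qed.

Let crossmom1 j : crossmom j 1 = 0.
Proof. by rewrite /crossmom mulr0 expr2 mulr0. Qed.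

Lemma centered_offdiag w i k : i != k ->
  centered w i k = \sum_j Z w i j * Z w k j.
Proof.
move=> ik; rewrite /centered mxE gramE !mxE [X in _ - X](@has_expectation_expect _ _ _ _ _ 0)
  ?subr0//.
have := has_expectation_sumX (fun b => cross_prod b ik) 1.
rewrite (sum_mom1 crossmom0 crossmom1); apply: eq_has_expectation => w'.
by rewrite expr1 gramE.
Qed.

Lemma centered_diag w i :
  centered w i i = \sum_j (Z w i j ^+ 2 - sigma j ^+ 2).
Proof.
rewrite /centered mxE gramE !mxE.
rewrite [X in _ - X](@has_expectation_expect _ _ _ _ _ (\sum_j sigma j ^+ 2)).
  by rewrite -sumrB.
have := has_expectation_sum (index_enum 'I_p2) (fun j (_ : true) => entry_moment i j 2).
rewrite (eq_bigr (fun j => sigma j ^+ 2)); last by move=> j _; rewrite mulr1.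
by apply: eq_has_expectation => w'; rewrite gramE.
Qed.

(** Off the diagonal each summand has variance [sigma^4] and fourth moment [9 sigma^8]; on it,
    [2 sigma^4] and [60 sigma^8]. The diagonal attains the ratio 15 exactly, which fixes that
    constant. *)
Lemma expect_norm_centered_ge i k :
  has_expectation P (fun w => `|centered w i k|) (expect P (fun w => `|centered w i k|)) /\
  7 / 36 * Num.sqrt (\sum_j sigma j ^+ 4) <= expect P (fun w => `|centered w i k|).
Proof.
have s4 (f : 'I_p2 -> R) : (forall j, sigma j ^+ 4 <= f j) ->
    7 / 36 * Num.sqrt (\sum_j sigma j ^+ 4) <= 7 / 36 * Num.sqrt (\sum_j f j).
  move=> sf; rewrite ler_wpM2l// ler_wsqrtr//; apply: ler_sum => j _; exact: sf.
have sX j n : 0 <= sigma j ^+ (2 * n) by rewrite exprM exprn_ge0// sqr_ge0.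
have [->|ik] := eqVneq i k.
  rewrite (_ : (fun w => _) = fun w => `|\sum_j (Z w k j ^+ 2 - sigma j ^+ 2)|); last first.
    by apply/funext => w; rewrite centered_diag.
  have [] := expect_norm_sum_ge (diag_prod k)
    (fun j => let: And4 H _ _ _ := diagmomE j in H)
    (fun j => let: And4 _ H _ _ := diagmomE j in H).
  - by move=> j; have [_ _ -> _] := diagmomE j; rewrite mulr_ge0// (sX j 2).
  - move=> j; have [_ _ -> ->] := diagmomE j.
    by rewrite le_eqVlt; apply/orP; left; apply/eqP; ring.
  - move=> h1 h2; split => //; apply: le_trans h2; apply: s4 => j.
    have [_ _ -> _] := diagmomE j; have := sX j 2; rewrite mulnn; lra.
rewrite (_ : (fun w => _) = fun w => `|\sum_j (Z w i j * Z w k j)|); last first.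
  by apply/funext => w; rewrite centered_offdiag.
have [] := expect_norm_sum_ge (fun b => cross_prod b ik) crossmom0 crossmom1.
- by move=> j; exact: sqr_ge0.
- move=> j; rewrite /crossmom /=.
  have -> : (sigma j ^+ 4 * 3%:R) ^+ 2 = 9 * sigma j ^+ 8 by ring.
  have -> : 15 * ((sigma j ^+ 2 * 1%:R) ^+ 2) ^+ 2 = 15 * sigma j ^+ 8 by ring.
  by have := sX j 4; rewrite (_ : (2 * 4)%N = 8)//; lra.
- move=> h1 h2; split => //; apply: le_trans h2; apply: s4 => j.
  by rewrite /crossmom mulr1 -exprM.
Qed.

(** * The two lower bounds for the expected norm *)

Let integral_norm := (\int[P]_w (spec_norm (centered w))%:E)%E.

(** The [p1] entries of column [i0] each contribute the same bound, and [p1 / sqrt p1 = sqrt p1].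
    The index [i0] also witnesses [p1 > 0]. *)
Lemma integral_norm_ge_frobenius (i0 : 'I_p1) :
  ((7 / 36 * Num.sqrt (p1%:R * \sum_j sigma j ^+ 4))%:E <= integral_norm)%E.
Proof.
have p0 : (0 < p1)%N := leq_ltn_trans (leq0n i0) (ltn_ord i0).
have sp0 : 0 < Num.sqrt (p1%:R : R) by rewrite sqrtr_gt0 ltr0n.
have HS := has_expectationZ (Num.sqrt p1%:R)^-1
  (has_expectation_sum (index_enum 'I_p1)
     (fun i (_ : true) => (expect_norm_centered_ge i i0).1)).
apply: le_trans (has_expectation_le_integral HS _ _); first last.
- by move=> w; exact: spec_norm_ge_sum_norm_col.
- by move=> w; exact: spec_norm_ge0.
rewrite lee_fin sqrtrM//.
set r := Num.sqrt p1%:R in sp0 *; set t := Num.sqrt (\sum_j _).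
have -> : 7 / 36 * (r * t) = r^-1 * (p1%:R * (7 / 36 * t)).
  have -> : p1%:R = r ^+ 2 by rewrite sqr_sqrtr.
  by field; rewrite gt_eqF.
apply: ler_wpM2l; first by rewrite invr_ge0 ltW.
apply: (@le_trans _ _ (\sum_(i < p1) 7 / 36 * Num.sqrt (\sum_j sigma j ^+ 4))).
  by rewrite sumr_const card_ord mulr_natl.
by apply: ler_sum => i _; exact: (expect_norm_centered_ge i i0).2.
Qed.

(* Unlike [Num.sg], this sign is [1] at [0], so that its square is [1] everywhere. *)
Let sgn (x : R) : R := 2 * \1_(`[0, +oo[ : set R) x - 1.

Let sgnE x : sgn x = if 0 <= x then 1 else -1.
Proof.
rewrite /sgn indicE; case: ifP => x0.
  by rewrite mem_set/= ?in_itv/= ?x0//; ring.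
by rewrite memNset/= ?in_itv/= ?x0//; ring.
Qed.

Let sgn_sqr x : sgn x ^+ 2 = 1.
Proof. by rewrite sgnE; case: ifP => _; rewrite ?sqrrN expr1n. Qed.

Let sgn_mul x : sgn x * x = `|x|.
Proof.
rewrite sgnE; case: ifP => [x0|/negbT]; first by rewrite mul1r ger0_norm.
by rewrite -ltNge mulN1r => x0; rewrite ltr0_norm.
Qed.

Let measurable_sgn : measurable_fun setT sgn.
Proof.
apply: measurable_funB => //; apply: measurable_funM => //.
Qed.

Let expect_sgn i j : exists v, has_expectation P (fun w => sgn (Z w i j)) v.
Proof.
have iS : P.-integrable setT (EFin \o (fun w => sgn (Z w i j))).
  apply: (@le_integrable _ _ _ P setT measurableT _ (cst 1%E)) => //.
  - by apply/measurable_EFinP; apply: measurableT_comp => //; exact: mZ.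
  - move=> w _; rewrite /= lee_fin sgnE; case: ifP => _; by rewrite ?normrN.
  - exact: finite_measure_integrable_cst.
exists (expect P (fun w => sgn (Z w i j))); split=> //.
by rewrite fineK//; exact: (integrable_fin_num measurableT iS).
Qed.

Let absZ i j := expect P (fun w => `|Z w i j|).

Let has_absZ i j : has_expectation P (fun w => `|Z w i j|) (absZ i j).
Proof.
have := entry_moment i j 1; rewrite mulr0 => e1.
by apply: has_expectation_norm; apply: eq_has_expectation e1.
Qed.

(** The general first-moment bound for a single Gaussian, whose fourth moment [3 sigma^4] is below
    [15 sigma^4]. *)
Let absZ_ge i j : 0 <= sigma j -> 7 / 36 * sigma j <= absZ i j.
Proof.
move=> s0.
have := expect_norm_ge_sqrt (eq_has_expectation (G := fun w => Z w i j) _ (entry_moment i j 1))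
  (entry_moment i j 2) (entry_moment i j 4).
move=> H; have : 7 / 36 * Num.sqrt (sigma j ^+ 2 * (std_normal_moment 2)%:R) <= absZ i j.
  apply: H; first by move=> w; rewrite expr1.
  rewrite /=; have := exprn_ge0 4 s0.
  have -> : 15 * (sigma j ^+ 2 * 1%:R) ^+ 2 = 15 * sigma j ^+ 4 by ring.
  by lra.
by rewrite mulr1 sqrtr_sqr ger0_norm.
Qed.

(** For [j = j0] the signs turn the entries into absolute values; for [j != j0] the centered entries
    are independent of the signs, so the mean vanishes. *)
Let sgn_cross i k j0 j : i != k ->
  has_expectation P
    (fun w => sgn (Z w i j0) * sgn (Z w k j0) * (Z w i j * Z w k j))
    (if j == j0 then absZ i j0 * absZ k j0 else 0).
Proof.
move=> ik.
pose g b x := (if b == j0 then sgn x else 1) * (if b == j then x else 1).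
have mg b : measurable_fun setT (g b).
  by rewrite /g; case: (b == j0); case: (b == j); apply: measurable_funM.
have gE l w : \prod_b g b (Z w l b) = sgn (Z w l j0) * Z w l j.
  have pick c (F : 'I_p2 -> R) : \prod_b (if b == c then F b else 1) = F c.
    by rewrite (bigD1 c)//= eqxx big1 ?mulr1// => b /negbTE ->.
  by rewrite big_split/= (pick j0 (fun b => sgn (Z w l b))) (pick j (fun b => Z w l b)).
have gv l : exists v, (forall b, has_expectation P (fun w => g b (Z w l b)) (v b)) /\
    \prod_b v b = if j == j0 then absZ l j0 else 0.
  have [y ey] := expect_sgn l j0.
  (* The mean [y] of the sign is unknown, but it occurs only for [j != j0], where column [j]
     contributes a factor 0. *)
  exists (fun b => if b == j0 then (if j == j0 then absZ l j0 else y)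
                   else if b == j then 0 else 1); split.
    move=> b; rewrite /g; have [->|bj0] := eqVneq b j0.
      rewrite [j0 == j]eq_sym; case: (j == j0).
        by apply: eq_has_expectation (has_absZ l j0) => w; rewrite sgn_mul.
      by apply: eq_has_expectation ey => w; rewrite mulr1.
    have [->|bj] := eqVneq b j.
      have := entry_moment l j 1; rewrite mulr0; apply: eq_has_expectation => w.
      by rewrite mul1r.
    by apply: eq_has_expectation (has_expectation_cst P 1) => w; rewrite mul1r.
  have [->|jj0] := eqVneq j j0.
    by rewrite (bigD1 j0)//= eqxx big1 ?mulr1// => b /negbTE ->.
  by rewrite (bigD1 j)//= (negbTE jj0) eqxx mul0r.
have [u [eu uE]] := gv i; have [v [ev vE]] := gv k.
have := two_rows_prod ik mg mg eu ev.
rewrite uE vE [X in has_expectation _ _ X](_ : _ =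
    if j == j0 then absZ i j0 * absZ k j0 else 0); last by case: ifP; rewrite ?mulr0.
by apply: eq_has_expectation => w; rewrite !gE; ring.
Qed.

(** The signs depend on [w], so the test vector is random. The diagonal has mean 0 because squared
    signs are 1; the [p1 (p1 - 1)] other terms, divided by [p1], give the factor [p1 - 1]. *)
Lemma integral_norm_ge_column (j0 : 'I_p2) : (0 < p1)%N -> 0 <= sigma j0 ->
  (((7 / 36) ^+ 2 * ((p1%:R - 1) * sigma j0 ^+ 2))%:E <= integral_norm)%E.
Proof.
move=> p0 s0.
have e i k : has_expectation P
    (fun w => sgn (Z w i j0) * sgn (Z w k j0) * centered w i k)
    (if i == k then 0 else absZ i j0 * absZ k j0).
  have [->|ik] := eqVneq i k.
    have := has_expectation_sumX (diag_prod k) 1.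
    rewrite sum_mom1; last 2 first.
    - by move=> j; have [] := diagmomE j.
    - by move=> j; have [] := diagmomE j.
    apply: eq_has_expectation => w.
    by rewrite expr1 centered_diag -expr2 sgn_sqr mul1r.
  have := has_expectation_sum (index_enum 'I_p2)
    (fun j (_ : true) => sgn_cross j0 j ik).
  rewrite -(big_mkcond (fun j => j == j0)) big_pred1_eq; apply: eq_has_expectation => w.
  by rewrite centered_offdiag// mulr_sumr.
have HS := has_expectationZ p1%:R^-1
  (has_expectation_sum (index_enum 'I_p1) (fun i (_ : true) =>
     has_expectation_sum (index_enum 'I_p1) (fun k (_ : true) => e i k))).
apply: le_trans (has_expectation_le_integral HS _ _); first last.
- by move=> w; apply: spec_norm_ge_sign_form => i; rewrite sgn_sqr.
- by move=> w; exact: spec_norm_ge0.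
rewrite lee_fin -ler_pdivrMl ?invr_gt0 ?ltr0n// invrK.
set y := (7 / 36) ^+ 2 * _.
apply: (@le_trans _ _ (\sum_(i < p1) y)); first by rewrite sumr_const card_ord mulr_natl.
apply: ler_sum => i _; rewrite (bigD1 i)//= eqxx add0r.
apply: (@le_trans _ _ (\sum_(k < p1 | k != i) ((7 / 36) ^+ 2 * sigma j0 ^+ 2))).
  rewrite sumr_const cardC1 card_ord /y -[leRHS]mulr_natl -subn1 natrB//.
  by rewrite [leLHS]mulrCA.
apply: ler_sum => k ki; rewrite eq_sym (negbTE ki).
rewrite -exprMn expr2.
by apply: ler_pM; rewrite ?mulr_ge0// absZ_ge.
Qed.

Lemma integral_norm_ge : (forall j, 0 <= sigma j) ->
  (((7 / 36) ^+ 2 / 3 * (Num.sqrt (p1%:R * \sum_(j < p2) sigma j ^+ 4)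
      + p1%:R * \big[Num.max/0]_(j < p2) sigma j ^+ 2))%:E <= integral_norm)%E.
Proof.
move=> s0.
have [p_eq0|p_neq0] := eqVneq p1 0%N.
  rewrite p_eq0 !mul0r sqrtr0 addr0 mulr0.
  by apply: integral_ge0 => w _; rewrite lee_fin spec_norm_ge0.
have p0 : (0 < p1)%N by rewrite lt0n.
have p1_ge1 : 1 <= p1%:R :> R by rewrite ler1n.
set s := Num.sqrt _; set M := \big[_/_]_(_ < _) _.
have B1 : ((7 / 36 * s)%:E <= integral_norm)%E.
  exact: (integral_norm_ge_frobenius (Ordinal p0)).
have S0 : 0 <= \sum_j sigma j ^+ 4 by apply: sumr_ge0 => j _; exact: exprn_ge0.
have [Ms B2] : M <= s /\ (((7 / 36) ^+ 2 * ((p1%:R - 1) * M))%:E <= integral_norm)%E.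
  (* The maximum starts from 0, so it is either that default, as when [p2 = 0], or attained at some
     column. *)
  have [->|[j ->]] : M = 0 \/ exists j, M = sigma j ^+ 2.
    rewrite /M; apply: (big_ind (fun x => x = 0 \/ exists j, x = sigma j ^+ 2)).
    - by left.
    - by move=> x y Hx Hy; rewrite /Num.max; case: ifP.
    - by move=> j _; right; exists j.
  - rewrite sqrtr_ge0 !mulr0; split => //.
    by apply: integral_ge0 => w _; rewrite lee_fin spec_norm_ge0.
  - split; last exact: integral_norm_ge_column.
    rewrite -[leLHS]ger0_norm ?sqr_ge0// -sqrtr_sqr ler_wsqrtr// -exprM.
    apply: (@le_trans _ _ (\sum_j sigma j ^+ 4)).
      by rewrite (bigD1 j)//= lerDl sumr_ge0// => l _; exact: exprn_ge0.
    by rewrite ler_peMl.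
set y1 := 7 / 36 * s in B1; set y2 := (7 / 36) ^+ 2 * _ in B2.
(* Write [p1 M = (p1 - 1) M + M] and bound the last [M] by [s]: this gives [2 k^2 s / 3 + y2 / 3]
   with [k = 7/36], and [k^2 <= k]. *)
have H : (7 / 36) ^+ 2 / 3 * (s + p1%:R * M) <= 2 / 3 * y1 + 1 / 3 * y2.
  have k0 : 0 <= 7 / 36 :> R by [].
  have k1 : 7 / 36 <= 1 :> R by lra.
  have ss0 : 0 <= s := sqrtr_ge0 _.
  rewrite /y1 /y2; move: k0 k1; set k := 7 / 36 => k0 k1.
  have : k ^+ 2 * s <= k * s by rewrite ler_wpM2r// expr2 ler_piMr.
  have : k ^+ 2 * M <= k ^+ 2 * s by rewrite ler_wpM2l// sqr_ge0.
  have -> : k ^+ 2 / 3 * (s + p1%:R * M) = (k ^+ 2 * s + k ^+ 2 * (p1%:R * M)) / 3 by ring.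
  have -> : k ^+ 2 * ((p1%:R - 1) * M) = k ^+ 2 * (p1%:R * M) - k ^+ 2 * M by ring.
  set a := k ^+ 2 * s; set b := k ^+ 2 * M; set e := k ^+ 2 * (_ * M); lra.
(* A convex combination is at most the larger of the two bounds, which avoids arithmetic with the
   extended real [integral_norm]. *)
have [y12|y21] := leP y1 y2.
  by apply: le_trans B2; rewrite lee_fin; apply: (le_trans H); lra.
by apply: le_trans B1; rewrite lee_fin; apply: (le_trans H); lra.
Qed.

End gaussian_matrix.

Theorem theorem3p7 :
  exists c : Rdefinitions.R, 0 < c /\
  forall (p1 p2 : nat) (sigma : 'I_p2 -> Rdefinitions.R),
  (forall j, 0 <= sigma j) ->
  forall (d : measure_display) (T : measurableType d)
         (P : probability T Rdefinitions.R)
         (Z : T -> 'M[Rdefinitions.R]_(p1, p2)),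
  entries_measurable Z ->
  entries_independent P Z ->
  (forall (i : 'I_p1) (j : 'I_p2) (A : set Rdefinitions.R), borel_set A ->
     P [set w | A (Z w i j)] = gauss_law (sigma j) A) ->
  ((c * (Num.sqrt (p1%:R * \sum_(j < p2) sigma j ^+ 4)
         + p1%:R * \big[Num.max/0]_(j < p2) sigma j ^+ 2))%:E
   <= \int[P]_w (spec_norm (Z w *m (Z w)^T
                  - expect_mx P (fun w' => Z w' *m (Z w')^T)))%:E)%E.
Proof.
(* The square comes from the product of two first absolute moments in the column bound, the 3 from
   the convex weights. *)
exists ((7 / 36) ^+ 2 / 3); split=> // p1 p2 sigma s0 d T P Z mZ indZ lawZ.
exact: integral_norm_ge.
Qed.
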